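(* Let $G=(V_G,E_G)$ be a finite simple connected graph of order $n$. The following are equivalent: (1) $G$ is $p$TS-distance-balanced for every $p\in[0,1]$; (2) $G\wr H$ is distance-balanced for every finite simple connected distance-balanced graph $H$; (3) $G\wr K_{n^32^n}$ is distance-balanced, where $K_N$ is the complete graph on $N$ vertices; (4) $G$ is $p$TS-distance-balanced for more than $n$ distinct values of $p\in[0,1]$; (5) the total distance vector $W_\rho(u,G)$ does not depend on the vertex $u\in V_G$.
   Context: For $A\subseteq V_G$, $\rho_A(u,v)$ is the length of a shortest walk in $G$ from $u$ to $v$ visiting every vertex of $A$ at least once. For $p\in[0,1]$, $p_A=p^{|A|}(1-p)^{n-|A|}$ (with $0^0=1$). For adjacent $u,v$, $W^A_{uv}=\{z\in V_G:\rho_A(z,u)<\rho_A(z,v)\}$ and $w^p_{uv}=\sum_{A\subseteq V_G}p_A|W^A_{uv}|$; $G$ is $p$TS-distance-balanced if $w^p_{uv}=w^p_{vu}$ for every edge $uv$. A graph $K$ is distance-balanced if for every edge $uv$, $|\{z:d_K(z,u)<d_K(z,v)\}|=|\{z:d_K(z,v)<d_K(z,u)\}|$ ($d_K$ geodesic distance). The total distance vector is $W_\rho(u,G)=(W_{\rho_0}(u,G),\dots,W_{\rho_n}(u,G))$ with $W_{\rho_k}(u,G)=\sum_{A\subseteq V_G,|A|=k}\sum_{v\in V_G}\rho_A(u,v)$. With $V_G=\{x_1,\dots,x_n\}$, the wreath product $G\wr H$ has vertex set $\{(y_1,\dots,y_n)x_i: y_j\in V_H, x_i\in V_G\}$, with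 $(y_1,\dots,y_n)x_i\sim(y'_1,\dots,y'_n)x_k$ iff either ($i=k$, $y_j=y'_j$ for $j\ne i$, $y_i\sim y'_i$ in $H$) or ($y_j=y'_j$ for all $j$ and $x_i\sim x_k$ in $G$). *)

(* Defs.v *)
From mathcomp Require Import all_boot all_order all_algebra.
From mathcomp Require Import boolp reals.

Set Implicit Arguments.
Unset Strict Implicit.
Unset Printing Implicit Defensive.

Import Order.TTheory GRing.Theory Num.Theory.

Record sgraph := SGraph {
  vertex :> finType;
  adj : rel vertex;
  adj_sym : symmetric adj;
  adj_irr : irreflexive adj
}.

Definition connected_graph (G : sgraph) : Prop :=
  forall u v : G, connect (@adj G) u v.

(* The value 0 on an empty predicate is a convention; below, it could only be
   taken on a pair of vertices that no walk joins. *)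
Definition least (P : pred nat) : nat :=
  if pselect (exists k, P k) is left exP then ex_minn exP else 0.

Section Distances.
Variable G : sgraph.

(* The vertices of the walk are u :: s, and its length is k = size s. *)
Definition has_walk (u v : G) (k : nat) : bool :=
  [exists s : k.-tuple G, path (@adj G) u s && (last u s == v)].

Definition has_walk_through (A : {set G}) (u v : G) (k : nat) : bool :=
  [exists s : k.-tuple G,
    [&& path (@adj G) u s, last u s == v & [forall x in A, x \in u :: s]]].

Definition dist (u v : G) : nat := least (has_walk u v).

Definition rho (A : {set G}) (u v : G) : nat := least (has_walk_through A u v).

Definition distance_balanced : Prop :=
  forall u v : G, adj u v ->
    #|[set z | dist z u < dist z v]| = #|[set z | dist z v < dist z u]|.

Definition Wset (A : {set G}) (u v : G) : {set G} :=
  [set z | rho A z u < rho A z v].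

(* The entries are indexed by k = 0, ..., n, where n is the order of G. *)
Definition total_distance_vector (u : G) : {ffun 'I_#|G|.+1 -> nat} :=
  [ffun k : 'I_#|G|.+1 =>
    \sum_(A : {set G} | #|A| == k) \sum_(v : G) rho A u v].

Section Weighted.
Variable R : realType.
Local Open Scope ring_scope.

Definition pweight (p : R) (A : {set G}) : R :=
  p ^+ #|A| * (1 - p) ^+ (#|G| - #|A|)%N.

Definition wsum (p : R) (u v : G) : R :=
  \sum_(A : {set G}) pweight p A * #|Wset A u v|%:R.

Definition pTS_distance_balanced (p : R) : Prop :=
  forall u v : G, adj u v -> wsum p u v = wsum p v u.

End Weighted.
End Distances.

Section Complete.
Variable N : nat.

Definition complete_adj : rel 'I_N := fun i j => i != j.

Lemma complete_adj_sym : symmetric complete_adj.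
Proof. by move=> i j; rewrite /complete_adj eq_sym. Qed.

Lemma complete_adj_irr : irreflexive complete_adj.
Proof. by move=> i; rewrite /complete_adj eqxx. Qed.

Definition complete_graph : sgraph := SGraph complete_adj_sym complete_adj_irr.

End Complete.

Section Wreath.
Variables G H : sgraph.

(* The vertex (y_1, ..., y_n) x_i is the pair (y, x_i), where the tuple y is
   indexed by the vertices of G themselves. *)
Definition wreath_adj : rel ({ffun G -> H} * G) := fun a b =>
  [&& a.2 == b.2,
      [forall j, (j != a.2) ==> (a.1 j == b.1 j)] &
      adj (a.1 a.2) (b.1 a.2)]
  || [forall j, a.1 j == b.1 j] && adj a.2 b.2.

Lemma wreath_adj_sym : symmetric wreath_adj.
Proof.
move=> [y x] [y' x']; rewrite /wreath_adj /= [adj x x']adj_sym; congr (_ || _).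
  rewrite [x' == x]eq_sym; case: eqP => //= <-; rewrite adj_sym.
  by congr (_ && _); apply: eq_forallb => j; rewrite [y j == _]eq_sym.
by congr (_ && _); apply: eq_forallb => j; rewrite eq_sym.
Qed.

Lemma wreath_adj_irr : irreflexive wreath_adj.
Proof. by move=> [y x]; rewrite /wreath_adj /= !adj_irr !andbF. Qed.

Definition wreath : sgraph := SGraph wreath_adj_sym wreath_adj_irr.

End Wreath.

(* Main.v *)
(** In the wreath product, d((f, w), (g, x)) = rho_A(w, x) + sum_j d_H(f_j, g_j),
    where A is the set of coordinates on which f and g differ.  Hence an edge that
    changes a lamp is balanced as soon as H is, while an edge moving from u to v is
    balanced iff the numbers a_k(u, v) = sum_{|A| = k} |W^A_uv| satisfy
    sum_k (|H| - 1)^k (a_k(u, v) - a_k(v, u)) = 0.  All five conditions amount to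
    a_k(u, v) = a_k(v, u) for every edge uv and every k: for (3), because the a_k are
    digits in base N - 1; for (1) and (4), because the polynomials p^k (1 - p)^(n - k)
    are independent of degree n; for (5), because rho_A(z, u) and rho_A(z, v) differ
    by at most 1, so that summing over z their difference is |W^A_vu| - |W^A_uv|. *)
Require Import Defs.
From mathcomp Require Import all_boot all_order all_algebra.
From mathcomp Require Import boolp reals.
From mathcomp Require Import zify.

(** * Walks through a prescribed set of vertices *)

Section Walks.
Set Implicit Arguments.
Unset Strict Implicit.
Unset Printing Implicit Defensive.

Lemma least_le (P : pred nat) k : P k -> least P <= k.
Proof.
move=> Pk; rewrite /least; case: pselect => [exP|[]]; last by exists k.
by case: ex_minnP => m _; apply.
Qed.

Lemma leastP (P : pred nat) k : P k -> P (least P).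
Proof.
move=> Pk; rewrite /least; case: pselect => [exP|[]]; last by exists k.
by case: ex_minnP.
Qed.

Variable G : sgraph.
Implicit Types (A B : {set G}) (u v w : G) (s : seq G).

Definition walk A u v s : Prop :=
  [/\ path (@adj G) u s, last u s = v & {subset A <= u :: s}].

Lemma has_walk_throughP A u v k :
  reflect (exists2 s, walk A u v s & size s = k) (has_walk_through A u v k).
Proof.
apply: (iffP existsP) => [[s /and3P[ps /eqP lsv /forall_inP sA]]|[s [ps lsv sA] sk]].
  by exists s; rewrite ?size_tuple.
exists (tcast sk (in_tuple s)); rewrite val_tcast /= ps lsv eqxx /=.
by apply/forall_inP.
Qed.

(** Lets every fact about geodesics be read off from the corresponding fact about [rho]. *)
Lemma dist_rho u v : dist u v = rho set0 u v.
Proof.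
rewrite /dist /rho; congr least; apply: funext => k.
apply: eq_existsb => s; congr (_ && _); rewrite -[LHS]andbT; congr (_ && _).
by apply/esym/forall_inP => x; rewrite inE.
Qed.

Lemma rho_le A u v s : walk A u v s -> rho A u v <= size s.
Proof. by move=> ws; apply: least_le; apply/has_walk_throughP; exists s. Qed.

Lemma walk_cat A B u v w s t :
  walk A u v s -> walk B v w t -> walk (A :|: B) u w (s ++ t).
Proof.
move=> [ps lsv sA] [pt ltw tB]; split; first by rewrite cat_path ps lsv.
  by rewrite last_cat lsv.
move=> x; rewrite inE => /orP[/sA|/tB]; rewrite !inE mem_cat.
  by case/orP=> ->; rewrite ?orbT.
by case/orP=> [/eqP->|->]; rewrite ?orbT // orbA -in_cons -lsv mem_last.
Qed.

Lemma walk_subset A B u v s : A \subset B -> walk B u v s -> walk A u v s.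
Proof. by move=> /subsetP AB [ps ls sB]; split=> // x /AB/sB. Qed.

(** Reversing [u :: s] gives a list headed by [v]; the start is not stored, hence [belast]. *)
Lemma walk_rev A u v s : walk A u v s -> walk A v u (rev (belast u s)).
Proof.
move=> [ps lsv sA]; split.
- by rewrite -lsv rev_path -(@eq_path _ (@adj G)) // => x y; rewrite adj_sym.
- by rewrite -lsv; case: s {ps lsv sA} => //= y s; rewrite rev_cons last_rcons.
- by move=> x /sA; rewrite lastI mem_rcons !inE mem_rev lsv.
Qed.

(** A walk visits its endpoint anyway, so requiring [v] costs nothing. *)
Lemma walk_reach_end A B u v s : A :\ v \subset B -> walk B u v s -> walk A u v s.
Proof.
move=> /subsetP AB [ps lsv sB]; split=> // x xA.
have [->|xv] := eqVneq x v; first by rewrite -lsv mem_last.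
by apply/sB/AB; rewrite !inE xv.
Qed.

Hypothesis Gconn : connected_graph G.

Lemma walk_exists A u v : exists s, walk A u v s.
Proof.
(* Visit the elements of [A] one after the other, concatenating connecting paths. *)
rewrite -[A]set_enum; elim: (enum A) u => [|x l IH] u.
  have /connectP[s ps ->] := Gconn u v; exists s; split=> // x.
  by rewrite inE.
have [t wt] := IH x; have /connectP[s ps xs] := Gconn u x.
exists (s ++ t); apply: walk_subset (walk_cat (A := [set x]) _ wt).
  by apply/subsetP => y; rewrite !inE.
by split=> // y; rewrite inE xs => /eqP ->; apply: mem_last.
Qed.

Lemma rho_walk A u v : exists2 s, walk A u v s & size s = rho A u v.
Proof.
have [s ws] := walk_exists A u v; apply/has_walk_throughP.
by apply: (@leastP _ (size s)); apply/has_walk_throughP; exists s.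
Qed.

Lemma rho_sym A u v : rho A u v = rho A v u.
Proof.
have le u' v' : rho A u' v' <= rho A v' u'.
  have [s ws <-] := rho_walk A v' u'.
  by rewrite -(size_belast v') -size_rev; apply/rho_le/walk_rev.
by apply/eqP; rewrite eqn_leq !le.
Qed.

Lemma rho_step A u v w : adj v w -> rho A u w <= (rho A u v).+1.
Proof.
move=> vw; have [s ws <-] := rho_walk A u v.
rewrite -addn1 -[1]/(size [:: w]) -size_cat; apply: rho_le.
rewrite -[A]setU0; apply: walk_cat ws _; split=> //=; first by rewrite vw.
by move=> x; rewrite inE.
Qed.

Lemma rho_setD1_end A B u v : A :\ v = B :\ v -> rho A u v = rho B u v.
Proof.
have le A' B' : A' :\ v = B' :\ v -> rho A' u v <= rho B' u v.
  move=> AB; have [s ws <-] := rho_walk B' u v.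
  by apply/rho_le/(walk_reach_end _ ws); rewrite AB subsetDl.
by move=> AB; apply/eqP; rewrite eqn_leq !le.
Qed.

Lemma dist_refl u : dist u u = 0.
Proof.
rewrite dist_rho; apply/eqP; rewrite -leqn0; apply: (@rho_le _ _ _ [::]).
by split=> // x; rewrite inE.
Qed.

Lemma dist_stepl u v w : adj u v -> dist u w <= (dist v w).+1.
Proof.
by move=> uv; rewrite !dist_rho ![rho _ _ w]rho_sym; apply: rho_step; rewrite adj_sym.
Qed.

(** Holds termwise in [z], by [rho_step] in both directions; the additive form avoids truncated
    subtraction. *)
Lemma sum_rho_edge A u v : adj u v ->
  \sum_z rho A v z + #|Wset A v u| = \sum_z rho A u z + #|Wset A u v|.
Proof.
move=> uv.
have cardW x y : #|Wset A x y| = \sum_z (rho A z x < rho A z y).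
  by rewrite -sum1_card big_mkcond; apply: eq_bigr => z _; rewrite inE; case: ltnP.
rewrite !cardW -!big_split /=; apply: eq_bigr => z _.
rewrite ![rho A _ z]rho_sym.
have := rho_step A z uv; have := rho_step A z (v := v) (w := u).
rewrite adj_sym uv => /(_ isT).
by case: ltngtP; lia.
Qed.

End Walks.

(** * The distance formula in a wreath product *)

Section WreathDistance.
Set Implicit Arguments.
Unset Strict Implicit.
Unset Printing Implicit Defensive.

Variables G H : sgraph.
Hypotheses (Gconn : connected_graph G) (Hconn : connected_graph H).
Implicit Types (f g : {ffun G -> H}) (u v w x : G).

Definition lamp_set f x (a : H) : {ffun G -> H} :=
  [ffun j => if j == x then a else f j].

Definition lamp_diff f g : {set G} := [set j | f j != g j].

Lemma lamp_set_path f x (a : H) (s : seq H) : path (@adj H) a s ->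
  path (@adj (wreath G H)) (lamp_set f x a, x) [seq (lamp_set f x b, x) | b <- s].
Proof.
apply: (homo_path (f := fun b => (lamp_set f x b, x) : wreath G H)) => b c bc.
apply/orP; left.
rewrite /= eqxx !ffunE eqxx bc andbT; apply/forall_inP => j jx.
by rewrite !ffunE (negbTE jx).
Qed.

(** Cost accounting: once lamp [x] is in its final state, it contributes nothing. *)
Lemma sum_dist_lamp_set f g x :
  \sum_j dist (f j) (g j) =
  dist (f x) (g x) + \sum_j dist (lamp_set f x (g x) j) (g j).
Proof.
rewrite (bigD1 x) //= [in RHS](bigD1 x) //= ffunE eqxx dist_refl add0n.
by congr (_ + _); apply: eq_bigr => j /negbTE jx; rewrite ffunE jx.
Qed.

Lemma lamp_walk f g x : exists t : seq (wreath G H),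
  [/\ path (@adj (wreath G H)) (f, x) t,
      last (f, x) t = (lamp_set f x (g x), x) &
      size t = dist (f x) (g x)].
Proof.
have [s [ps ls _] ss] := rho_walk Hconn set0 (f x) (g x).
have fE : f = lamp_set f x (f x).
  by apply/ffunP => j; rewrite ffunE; case: eqP => // ->.
exists [seq (lamp_set f x b, x) | b <- s]; split.
- by rewrite {1}fE; apply: lamp_set_path.
- by rewrite {1}fE (last_map (fun b => (lamp_set f x b, x))) ls.
- by rewrite size_map ss dist_rho.
Qed.

(* At each vertex of the base walk, first bring its lamp to the final state. *)
Lemma wreath_walk s w f g : path (@adj G) w s ->
  {subset lamp_diff f g <= w :: s} ->
  exists t : seq (wreath G H),
    [/\ path (@adj (wreath G H)) (f, w) t, last (f, w) t = (g, last w s) &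
        size t = size s + \sum_j dist (f j) (g j)].
Proof.
elim: s w f => [|w' s IH] w f /= ps fg.
  have [t [pt lt st]] := lamp_walk f g w.
  have E : lamp_set f w (g w) = g.
    apply/ffunP => j; rewrite ffunE; case: eqP => [->//|jw].
    by apply/eqP/negPn/negP => fgj; have := fg j; rewrite !inE fgj => /(_ isT)/eqP.
  exists t; rewrite lt st (sum_dist_lamp_set f g w) E; split=> //.
  by rewrite big1 ?addn0 // => j _; apply: dist_refl.
have [t [pt lt st]] := lamp_walk f g w.
have /andP[ww' ps'] := ps.
(* Lamp [w] is now settled, so the remaining differences lie on the rest of the walk. *)
have [|t' [pt' lt' st']] := IH w' (lamp_set f w (g w)) ps'.
  move=> j; rewrite inE ffunE; have [->|jw fgj] := eqVneq j w; first by rewrite eqxx.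
  by have := fg j; rewrite inE [_ \in w :: _]inE (negbTE jw) => /(_ fgj).
exists (t ++ ((lamp_set f w (g w), w') : wreath G H) :: t'); split.
- rewrite cat_path pt lt /= pt' andbT; apply/orP; right.
  by rewrite /= ww' andbT; apply/forallP.
- by rewrite last_cat.
- by rewrite size_cat /= st st' (sum_dist_lamp_set f g w); lia.
Qed.

(** Lower bound for the distance. The moves of [t] form a base walk, which must visit every lamp
    that changes, since only the lamp at the current position can change; each lamp step lowers the
    sum of distances by at most one. *)
Lemma wreath_walk_proj (t : seq (wreath G H)) f w g x :
  path (@adj (wreath G H)) (f, w) t -> last (f, w) t = (g, x) ->
  exists2 s, walk (lamp_diff f g) w x s &
    size s + \sum_j dist (f j) (g j) <= size t.
Proof.
elim: t f w => [|[f' w'] t IH] f w /=.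
  move=> _ [<- <-]; exists [::]; first by split=> // j; rewrite inE eqxx.
  by rewrite big1 // => j _; apply: dist_refl.
move=> /andP[/orP[/and3P[/= /eqP <- /forall_inP ff' aff']|/andP[/= /forallP ff' ww']]
  pt] lt; have [s [ps ls sd] les] := IH _ _ pt lt.
  exists s; first split=> //.
    move=> j; rewrite inE => fgj; have [->|jw] := eqVneq j w; first by rewrite mem_head.
    by apply: sd; rewrite inE -(eqP (ff' _ jw)).
  (* The base walk is unchanged; isolate lamp [w], whose distance drops by at most one, the other
     terms being equal. *)
  apply: leq_trans (_ : (size s + \sum_j dist (f' j) (g j)).+1 <= _); last by [].
  rewrite -addnS leq_add2l (bigD1 w) //= [X in _ <= X.+1](bigD1 w) //= -addSn.
  apply: leq_add; first exact: dist_stepl.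
  by apply: eq_leq; apply: eq_bigr => j jw; rewrite (eqP (ff' _ jw)).
have ? : f = f' by apply/ffunP => j; apply/eqP.
subst f'; exists (w' :: s) => //; split=> //=; first by rewrite ww'.
by move=> j /sd; rewrite [_ \in w :: _]inE orbC => ->.
Qed.

Lemma wreath_connected : connected_graph (wreath G H).
Proof.
move=> [f w] [g x]; have [s [ps ls sd]] := walk_exists Gconn (lamp_diff f g) w x.
have [t [pt lt _]] := wreath_walk ps sd.
by apply/connectP; exists t; rewrite ?lt ?ls.
Qed.

Lemma wreath_dist f w g x :
  @dist (wreath G H) (f, w) (g, x) =
  rho (lamp_diff f g) w x + \sum_j dist (f j) (g j).
Proof.
apply/eqP; rewrite eqn_leq !dist_rho; apply/andP; split.
  have [s [ps ls sd] <-] := rho_walk Gconn (lamp_diff f g) w x.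
  have [t [pt lt <-]] := wreath_walk ps sd.
  by apply: rho_le; split=> //; [rewrite lt ls | move=> y; rewrite inE].
have [t [pt lt _] <-] := rho_walk wreath_connected set0 (f, w) (g, x).
have [s ws] := wreath_walk_proj pt lt.
by apply: leq_trans; rewrite leq_add2r; apply: rho_le.
Qed.

End WreathDistance.

(** * Counting closer vertices in the wreath product *)

Section Layers.
Set Implicit Arguments.
Unset Strict Implicit.
Unset Printing Implicit Defensive.

(** These are the numbers a_k(u, v); for k beyond the order of [G] the sum is empty. *)
Definition layer (G : sgraph) (k : nat) (u v : G) : nat :=
  \sum_(A : {set G} | #|A| == k) #|Wset A u v|.

Definition layer_balanced (G : sgraph) : Prop :=
  forall (u v : G) k, adj u v -> layer k u v = layer k v u.

Lemma big_sets_by_card (T : finType) (S : Type) (idx : S) (op : Monoid.com_law idx)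
    (F : {set T} -> S) :
  \big[op/idx]_(A : {set T}) F A =
  \big[op/idx]_(k < #|T|.+1) \big[op/idx]_(A : {set T} | #|A| == k) F A.
Proof.
(* The cardinal of [A] is at most [#|T|], so [inord] does not truncate it. *)
rewrite (partition_big (fun A : {set T} => inord #|A| : 'I_#|T|.+1) predT) //=.
apply: eq_bigr => k _; apply: eq_bigl => A.
by rewrite -val_eqE /= inordK // ltnS max_card.
Qed.

(** Crude bound: there are 2^n sets [A], each contributing at most n. It tells how large the base of
    the digit argument must be. *)
Lemma layer_le (G : sgraph) k (u v : G) : layer k u v <= #|G| * 2 ^ #|G|.
Proof.
apply: (@leq_trans (\sum_(A : {set G}) #|G|)).
  rewrite /layer big_mkcond; apply: leq_sum => A _.
  by case: ifP => // _; apply: max_card.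
by rewrite sum_nat_const -(cardsT {set G}) -powersetT card_powerset cardsT mulnC.
Qed.

Variables G H : sgraph.
Hypotheses (Gconn : connected_graph G) (Hconn : connected_graph H).

(** The values of [f] are chosen independently: off [A] the value is forced, on [A] any of the |H| -
    1 others is allowed. *)
Lemma card_lamp_diff (y : {ffun G -> H}) (A : {set G}) :
  #|[set f | lamp_diff f y == A]| = #|H|.-1 ^ #|A|.
Proof.
pose F j := if j \in A then predC1 (y j) else pred1 (y j).
rewrite (eq_card (B := family F)) => [|f]; last first.
  rewrite inE; apply/eqP/familyP => [fA j|fF].
    by rewrite /F -fA inE; case: (f j =P y j) => fy; rewrite !inE; apply/eqP.
  apply/setP => j; have := fF j; rewrite /F !inE.
  by case: ifP => _; rewrite !inE => // ->.
rewrite card_family foldrE big_map big_enum /=.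
rewrite -prod_nat_const [RHS]big_mkcond; apply: eq_bigr => j _.
by rewrite /F; case: ifP => _; rewrite ?card1 // cardC1.
Qed.

(** Both distances contain the same sum over lamps, which cancels and leaves a comparison of [rho];
    then group the [f] by [lamp_diff f y], and these sets by size. *)
Lemma card_closer_move (y : {ffun G -> H}) (u v : G) :
  #|[set z : wreath G H | dist z (y, u) < dist z (y, v)]| =
  \sum_(k < #|G|.+1) layer k u v * #|H|.-1 ^ k.
Proof.
transitivity (\sum_(f : {ffun G -> H}) #|Wset (lamp_diff f y) u v|).
  rewrite -sum1dep_card big_mkcond /=.
  pose c (f : {ffun G -> H}) (w : G) : nat :=
    rho (lamp_diff f y) w u < rho (lamp_diff f y) w v.
  transitivity (\sum_f \sum_w c f w).
    rewrite pair_big /=; apply: eq_bigr => -[f w] _ /=.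
    by rewrite !(wreath_dist Gconn Hconn) ltn_add2r /c; case: ltnP.
  apply: eq_bigr => f _.
  by rewrite -sum1dep_card [RHS]big_mkcond; apply: eq_bigr => w _; rewrite /c; case: ltnP.
rewrite (partition_big (fun f => lamp_diff f y) predT) //= big_sets_by_card.
apply: eq_bigr => k _; rewrite /layer big_distrl /=; apply: eq_bigr => A /eqP cA.
rewrite (eq_bigr (fun=> #|Wset A u v|)) => [|f /eqP -> //].
by rewrite sum_nat_const mulnC -cA -(card_lamp_diff y) [#|[set f | _]|]cardsE.
Qed.

(** The two difference sets agree except perhaps at the endpoint [x], so the [rho] terms are equal,
    and so are the contributions of all lamps other than [x]. *)
Lemma closer_lampE (y y' : {ffun G -> H}) (x : G) :
  (forall j, j != x -> y j = y' j) ->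
  [set z : wreath G H | dist z (y, x) < dist z (y', x)] =
  [set z : wreath G H | dist (z.1 x) (y x) < dist (z.1 x) (y' x)].
Proof.
move=> yy'; apply/setP => -[f w]; rewrite !inE !(wreath_dist Gconn Hconn) /=.
rewrite (@rho_setD1_end _ Gconn _ (lamp_diff f y')); last first.
  by apply/setP => j; rewrite !inE; case: eqVneq => //= /yy' ->.
rewrite ltn_add2l (bigD1 x) //= [X in _ < X](bigD1 x) //=.
rewrite (eq_bigr (fun j => dist (f j) (y' j))) ?ltn_add2r //.
by move=> j /yy' ->.
Qed.

(** Only the lamp at [x] is constrained; the position and the other lamps contribute the same factor
    on both sides. *)
Lemma card_lamp_pred (x : G) (P Q : pred H) :
  #|[set a | P a]| = #|[set a | Q a]| ->
  #|[set z : wreath G H | P (z.1 x)]| = #|[set z : wreath G H | Q (z.1 x)]|.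
Proof.
have E (S : pred H) : [set z : wreath G H | S (z.1 x)] =
    setX [set f : {ffun G -> H} | S (f x)] [set: G].
  by apply/setP => -[f w]; rewrite !inE andbT.
have F (S : pred H) : #|[set f : {ffun G -> H} | S (f x)]| =
    \prod_(j : G) (if j == x then #|[set a | S a]| else #|H|).
  rewrite (eq_card (B := family
    (fun j => if j == x then [set a | S a] else [set: H]))).
    rewrite card_family foldrE big_map big_enum /=.
    by apply: eq_bigr => j _; case: eqP; rewrite ?cardsT.
  move=> f; rewrite inE; apply/idP/familyP => [fS j|/(_ x)].
    by case: eqP => [->|]; rewrite inE.
  by rewrite eqxx inE.
by move=> PQ; rewrite !E !cardsX !F PQ.
Qed.

Lemma layer_balanced_wreath :
  layer_balanced G -> distance_balanced H -> distance_balanced (wreath G H).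
Proof.
move=> Gbal Hbal [y x] [y' x'] /orP[/= /and3P[/eqP <- /forall_inP yy' adjy]|].
  have yy j : j != x -> y j = y' j by move/yy'/eqP.
  have y'y j : j != x -> y' j = y j by move/yy.
  rewrite (closer_lampE yy) (closer_lampE y'y).
  exact: (card_lamp_pred x (Hbal _ _ adjy)).
move=> /andP[/= /forallP yy' adjx].
have <- : y = y' by apply/ffunP => j; apply/eqP.
by rewrite !card_closer_move; apply: eq_bigr => k _; rewrite Gbal.
Qed.

End Layers.

(** * Uniqueness of digits and independence of Bernstein forms *)

Section Characterizations.
Set Implicit Arguments.
Unset Strict Implicit.
Unset Printing Implicit Defensive.
Import Order.TTheory GRing.Theory Num.Theory.

(** Reduction modulo [M] gives the lowest digit; cancel it, divide by [M] and induct. *)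
Lemma digits_inj (M n : nat) (a b : nat -> nat) :
  (forall k, a k < M) -> (forall k, b k < M) ->
  \sum_(k < n) a k * M ^ k = \sum_(k < n) b k * M ^ k ->
  forall k, k < n -> a k = b k.
Proof.
elim: n a b => [|n IH] a b aM bM //.
have E (c : nat -> nat) :
    \sum_(k < n.+1) c k * M ^ k = (\sum_(k < n) c k.+1 * M ^ k) * M + c 0.
  rewrite big_ord_recl muln1 addnC big_distrl /=; congr (_ + _).
  by apply: eq_bigr => k _; rewrite expnSr mulnA.
rewrite !E => eqab.
have M0 : 0 < M by apply: leq_ltn_trans (aM 0).
have ab0 : a 0 = b 0.
  by have /(congr1 (modn^~ M)) := eqab; rewrite !modnMDl !modn_small.
move: eqab; rewrite ab0 => /addIn/eqP; rewrite eqn_pmul2r // => /eqP eqab.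
case=> [|k]; rewrite ?ltnS // => kn.
exact: (IH (fun k => a k.+1) (fun k => b k.+1)).
Qed.

Section Bernstein.
Local Open Scope ring_scope.

(* The substitution t = p / (1 - p) turns the Bernstein form into the monomial
   one. *)
Lemma bernstein_eq0 (F : numFieldType) (n : nat) (c : nat -> F) (s : seq F) :
  uniq s -> (n < size s)%N ->
  (forall p, p \in s -> \sum_(k < n.+1) p ^+ k * (1 - p) ^+ (n - k) * c k = 0) ->
  forall k, (k <= n)%N -> c k = 0.
Proof.
move=> us ns cs0.
pose B : {poly F} := \sum_(k < n.+1) c k *: ('X^k * (1 - 'X) ^+ (n - k)).
have BE p : B.[p] = \sum_(k < n.+1) p ^+ k * (1 - p) ^+ (n - k) * c k.
  rewrite horner_sum; apply: eq_bigr => k _.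
  by rewrite !hornerE /= -mulrA [RHS]mulrC.
(* [B] has degree at most n but more than n roots. *)
have B0 : B = 0.
  apply: (@roots_geq_poly_eq0 _ _ s) => //.
    by apply/allP => p /cs0; rewrite /root BE => ->.
  apply: leq_trans ns; apply: (leq_trans (size_sum _ _ _)).
  apply/bigmax_leqP => k _; apply: leq_trans (size_scale_leq _ _) _.
  apply: leq_trans (size_polyMleq _ _) _; rewrite size_polyXn /=.
  have : (size ((1 - 'X : {poly F}) ^+ (n - k)) <= (n - k).+1)%N.
    apply: leq_trans (size_poly_exp_leq _ _) _.
    by rewrite -size_polyN opprB size_XsubC /= mul1n.
  by rewrite -(leq_add2l k) addnS subnKC // -ltnS.
pose T : {poly F} := \poly_(k < n.+1) c k.
have T0 : T = 0.
  (* At p = i / (1 + i) one has 1 - p = 1 / (1 + i), so (1 + i)^n B(p) = T(i). Hence 0, ..., n are n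
     + 1 distinct roots of [T]. *)
  pose r := [seq i%:R : F | i <- iota 0 n.+1].
  apply: (@roots_geq_poly_eq0 _ _ r).
  - apply/allP => t /mapP[i _ ->]; rewrite /root horner_poly.
    have i0 : 1 + i%:R != 0 :> F by rewrite -mulrS pnatr_eq0.
    have : (1 + i%:R) ^+ n * B.[i%:R / (1 + i%:R)] = 0 by rewrite B0 horner0 mulr0.
    rewrite BE big_distrr /= => /eqP; congr (_ == 0); apply: eq_bigr => k _.
    have -> : 1 - i%:R / (1 + i%:R) = (1 + i%:R)^-1 :> F.
      by rewrite -{1}(divff i0) -mulrBl addrK mul1r.
    have kn : (k <= n)%N by rewrite -ltnS.
    rewrite exprMn -[_ * _ * (_ ^+ (n - k))]mulrA -exprD subnKC // exprVn.
    by rewrite mulrA mulrCA divff ?expf_neq0 // mulr1 mulrC.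
  - by rewrite map_inj_uniq ?iota_uniq // => i j /eqP; rewrite eqr_nat => /eqP.
  - by rewrite size_map size_iota size_poly.
move=> k kn; have := congr1 (fun q : {poly F} => q`_k) T0.
by rewrite coef_poly ltnS kn coef0.
Qed.

End Bernstein.

(** * Weighted balance at sufficiently many parameters *)

Section Wsum.
Variables (R : realType) (G : sgraph).
Local Open Scope ring_scope.

Lemma wsum_layer (p : R) (u v : G) :
  wsum p u v =
  \sum_(k < #|G|.+1) p ^+ k * (1 - p) ^+ (#|G| - k) * (layer k u v)%:R.
Proof.
rewrite /wsum big_sets_by_card; apply: eq_bigr => k _.
rewrite /layer natr_sum big_distrr /=; apply: eq_bigr => A /eqP cA.
by rewrite /pweight cA.
Qed.

Lemma layer_balanced_pTS (p : R) : layer_balanced G -> pTS_distance_balanced G p.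
Proof.
move=> bal u v uv; rewrite !wsum_layer; apply: eq_bigr => k _.
by rewrite (bal u v).
Qed.

Lemma layer_card_gt (k : nat) (u v : G) : (#|G| < k)%N -> layer k u v = 0%N.
Proof.
move=> Gk; rewrite /layer big_pred0 // => A; apply/negbTE.
by rewrite neq_ltn (leq_ltn_trans (max_card _) Gk).
Qed.

(** On an edge, the difference of the two weighted sums is a Bernstein form with coefficients a_k(u,
    v) - a_k(v, u), vanishing at more than n points. *)
Lemma pTS_layer_balanced (s : seq R) : uniq s -> (#|G| < size s)%N ->
  (forall p, p \in s -> pTS_distance_balanced G p) -> layer_balanced G.
Proof.
move=> us Gs bal u v k uv; have [kG|Gk] := leqP k #|G|; last by rewrite !layer_card_gt.
apply/eqP; rewrite -(eqr_nat R) -subr_eq0; apply/eqP.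
pose c j := (layer j u v)%:R - (layer j v u)%:R : R.
apply: (@bernstein_eq0 _ #|G| c s) => // p ps.
have := bal p ps u v uv; rewrite !wsum_layer => /eqP.
rewrite -subr_eq0 -sumrB => /eqP E; rewrite -[RHS]E.
by apply: eq_bigr => j _; rewrite mulrBr.
Qed.

(** The points 1, 1/2, ..., 1/(n + 1) serve both to exploit balance on all of [0, 1] and as the
    witness for condition (4). *)
Lemma unit_interval_points (n : nat) : exists s : seq R,
  [/\ uniq s, (n < size s)%N & forall p, p \in s -> 0 <= p <= 1].
Proof.
exists [seq i.+1%:R^-1 | i <- iota 0 n.+1]; split.
- rewrite map_inj_uniq ?iota_uniq // => i j /invr_inj/eqP.
  by rewrite eqr_nat => /eqP[].
- by rewrite size_map size_iota.
- move=> p /mapP[i _ ->]; rewrite invr_ge0 ler0n /= invf_le1 ?ltr0n //.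
  by rewrite ler1n.
Qed.

End Wsum.

(** * Total distances and complete lamp graphs *)

Section Graph.
Variable G : sgraph.
Hypothesis Gconn : connected_graph G.

Lemma total_distance_edge (u v : G) (k : 'I_#|G|.+1) : adj u v ->
  total_distance_vector v k + layer k v u = total_distance_vector u k + layer k u v.
Proof.
move=> uv; rewrite !ffunE -!big_split /=; apply: eq_bigr => A _.
exact: sum_rho_edge.
Qed.

Lemma layer_balanced_total_distance : layer_balanced G <->
  forall u v : G, total_distance_vector u = total_distance_vector v.
Proof.
split=> [bal u v|tot u v k uv]; last first.
  have [kG|Gk] := ltnP k #|G|.+1; last by rewrite !layer_card_gt.
  by have := total_distance_edge (Ordinal kG) uv; rewrite (tot u v) => /addnI.
(* By connectedness it suffices to compare adjacent vertices along a path. *)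
have /connectP[s ps ->] := Gconn u v.
elim: s u ps => //= w s IH u /andP[uw /IH <-].
apply/ffunP => k; have := total_distance_edge k uw.
by rewrite (bal u w) // => /addIn.
Qed.

Lemma complete_connected N : connected_graph (complete_graph N).
Proof.
move=> i j; have [->|ij] := eqVneq i j; first exact: connect0.
exact: connect1.
Qed.

Lemma complete_dist N (i j : complete_graph N) : dist i j = (i != j).
Proof.
have [->|ij] := eqVneq i j; first exact: dist_refl.
apply/eqP; rewrite eqn_leq dist_rho; apply/andP; split.
  apply: (@rho_le _ _ _ _ [:: j]); split=> //=; first by rewrite andbT.
  by move=> x; rewrite inE.
have [[|x s] [_ /= ls _] <-] := rho_walk (@complete_connected N) set0 i j => //.
by rewrite ls eqxx in ij.
Qed.

Lemma complete_distance_balanced N : distance_balanced (complete_graph N).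
Proof.
move=> i j ij.
have E (a b : complete_graph N) : a != b -> [set z | dist z a < dist z b] = [set a].
  move=> ab; apply/setP => z; rewrite !inE !complete_dist.
  by have [->|_] := eqVneq z a; rewrite ?ab //; case: eqP.
by rewrite !E ?cards1 // eq_sym.
Qed.

(** The bound on [N] makes every a_k smaller than the base |H| - 1 = N - 1, so the a_k are genuine
    digits. *)
Lemma wreath_complete_layer_balanced N : #|G| * 2 ^ #|G| < N.-1 ->
  distance_balanced (wreath G (complete_graph N)) -> layer_balanced G.
Proof.
move=> GN bal u v k uv; have [kG|Gk] := ltnP k #|G|.+1; last by rewrite !layer_card_gt.
have N0 : 0 < N by lia.
(* The lamps stay fixed along the edge, so any configuration will do; a constant one exists as N >
   0. *)
pose y : {ffun G -> complete_graph N} := [ffun=> Ordinal N0].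
have adjy : @adj (wreath G (complete_graph N)) (y, u) (y, v).
  by apply/orP; right; rewrite /= uv andbT; apply/forallP.
have small w x j : @layer G j w x < N.-1 by apply: leq_ltn_trans (layer_le _ _ _) GN.
have := bal _ _ adjy; rewrite !(card_closer_move Gconn (@complete_connected N)).
rewrite card_ord => E.
exact: (digits_inj (small u v) (small v u) E).
Qed.

End Graph.
End Characterizations.

Theorem theorem3p12 (R : realType) (G : sgraph) (n : nat)
    (Gconn : connected_graph G) (Gorder : #|G| = n) :
  [<-> (forall p : R, (0 <= p <= 1)%R -> pTS_distance_balanced G p);
       (forall H : sgraph, connected_graph H -> distance_balanced H ->
          distance_balanced (wreath G H));
       distance_balanced (wreath G (complete_graph (n ^ 3 * 2 ^ n)));
       (exists s : seq R,
          [/\ uniq s, n < size s,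
              forall p : R, p \in s -> (0 <= p <= 1)%R &
              forall p : R, p \in s -> pTS_distance_balanced G p]);
       (forall u v : G, total_distance_vector u = total_distance_vector v)].
Proof.
have [s [us ns s01]] := unit_interval_points R n.
tfae.
- move=> bal H Hconn; apply: layer_balanced_wreath => //.
  by apply: (pTS_layer_balanced us); rewrite ?Gorder // => p /s01/bal.
- by apply; [exact: complete_connected | exact: complete_distance_balanced].
- move=> bal; suff lbal : layer_balanced G.
    by exists s; split=> // p _; apply: layer_balanced_pTS.
  move=> u v k uv; apply: (wreath_complete_layer_balanced Gconn _ bal) => //.
  (* The edge forces n >= 2, whence n^3 >= 4n and n 2^n < n^3 2^n - 1; this inequality fails at n =
     1. *)
  have n2 : 1 < n.
    rewrite -Gorder; apply/card_gt1P; exists u, v; split=> //.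
    by apply: contraTneq uv => ->; rewrite adj_irr.
  have m0 : 0 < n * 2 ^ n by rewrite muln_gt0 expn_gt0 ltnW.
  have : 4 * (n * 2 ^ n) <= n ^ 3 * 2 ^ n.
    by rewrite mulnA leq_mul2r expnSr leq_mul2r -[4]/(2 ^ 2) leq_exp2r // n2 !orbT.
  by rewrite Gorder; move: (n * 2 ^ n) (n ^ 3 * 2 ^ n) m0 => a b; lia.
- move=> [t [ut nt _ bal]]; apply/layer_balanced_total_distance => //.
  by apply: (pTS_layer_balanced ut); rewrite ?Gorder.
- by move=> /layer_balanced_total_distance-/(_ Gconn) bal p _; apply: layer_balanced_pTS.
Qed.
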